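(* Let $n\ge 3$ and let $g=\sum_{i=1}^n dx_i^2$ be the Euclidean metric on $\mathbb{R}^n$ with coordinates $x_1,\dots,x_n$. Fix $k\in\{1,\dots,n\}$ and let $R=T\odot g$ where $T=\sum_{i=1}^n f_i(x_k)\,dx_i^2$ and $f_1,\dots,f_n$ are smooth functions depending only on the variable $x_k$, such that $3f_i(x_k)+f_j(x_k)\neq0$ for all $x_k\in\mathbb{R}$ and all $i\neq j$. Then there exists a metric $\bar g=\frac{1}{\varphi^2}g$ on $\mathbb{R}^n$ (with $\varphi$ a positive smooth function) whose Riemannian curvature tensor satisfies $\bar R=R$ if and only if all the functions $f_i$ with $i\neq k$ are equal to one another, say $f_i=f$ for $i\ne k$, and for some constant $C>0$ the functions $f$ and $f_k$ satisfy the system $$\begin{cases}\displaystyle\frac12\left(\frac{f_{,x_k}}{3f+f_k}\right)^2-\left(\frac{f_{,x_k}}{3f+f_k}\right)_{,x_k}=C^2f_k\,v,\\[2mm] \displaystyle-\left(\frac{f_{,x_k}}{3f+f_k}\right)^2=2C^2f\,v,\end{cases}$$ where $v=v(x_k)=\exp\left(-2\int\frac{f_{,x_k}}{3f+f_k}\,dx_k\right)$. If $f_k$ and $f$ satisfy these conditions, then $\varphi$ depends only on $x_k$ and is given by $$\varphi(x_k)=C\exp\left(-\int\frac{f_{,x_k}}{3f+f_k}\,dx_k\right).$$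
   Context: Subscripts $_{,x_k}$ denote derivatives with respect to $x_k$; $\int\frac{f_{,x_k}}{3f+f_k}\,dx_k$ denotes one fixed antiderivative, the same in all places. For symmetric $(0,2)$-tensors $h,l$ the Kulkarni–Nomizu product is $(h\odot l)(X,Y,Z,W)=h(X,Z)l(Y,W)+h(Y,W)l(X,Z)-h(X,W)l(Y,Z)-h(Y,Z)l(X,W)$. The Riemannian curvature $(0,4)$-tensor is taken with the sign convention for which a metric $\tilde g$ of constant sectional curvature $c$ has curvature tensor $\frac{c}{2}\,\tilde g\odot\tilde g$; equivalently $R_{\tilde g}=W_{\tilde g}+A_{\tilde g}\odot\tilde g$ with $W_{\tilde g}$ the Weyl tensor and $A_{\tilde g}=\frac{1}{n-2}\left(\mathrm{Ric}_{\tilde g}-\frac{K_{\tilde g}}{2(n-1)}\tilde g\right)$ the Schouten tensor, $K_{\tilde g}$ being the scalar curvature. *)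

(* Defs.v *)
From HB Require Import structures.
From mathcomp Require Import all_boot all_order all_algebra.
From mathcomp Require Import boolp classical_sets functions reals.
From mathcomp Require Import topology normedtype sequences derive realfun exp.

Set Implicit Arguments.
Unset Strict Implicit.
Unset Printing Implicit Defensive.

Import Order.TTheory GRing.Theory Num.Theory.
Import numFieldNormedType.Exports.

Local Open Scope ring_scope.
Local Open Scope classical_set_scope.

(* Tensor fields on R^n = 'rV[R]_n are given by their components in the
   global coordinate frame; a symmetric (0,2)-tensor is a matrix. *)

Definition partial (R : realType) (n : nat) (i : 'I_n)
    (F : 'rV[R]_n -> R) (x : 'rV[R]_n) : R :=
  'D_(delta_mx 0 i) F x.

Fixpoint Ck (R : realType) (n : nat) (r : nat) (F : 'rV[R]_n -> R) : Prop :=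
  continuous F /\
  if r is r'.+1 then
    forall i : 'I_n,
      (forall x, derivable F x (delta_mx 0 i)) /\ Ck r' (partial i F)
  else True.

Definition smooth (R : realType) (n : nat) (F : 'rV[R]_n -> R) : Prop :=
  forall r, Ck r F.

Definition smooth1 (R : realType) (f : R -> R) : Prop :=
  forall r t, derivable (f^`(r)) t 1.

Definition tensor4 (R : realType) (n : nat) : Type :=
  'I_n -> 'I_n -> 'I_n -> 'I_n -> R.

Definition kulkarni_nomizu (R : realType) (n : nat) (h l : 'M[R]_n) :
    tensor4 R n :=
  fun a b c d =>
    h a c * l b d + h b d * l a c - h a d * l b c - h b c * l a d.

Definition euclidean (R : realType) (n : nat) : 'M[R]_n := 1%:M.

Definition conformal (R : realType) (n : nat) (phi : 'rV[R]_n -> R)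
    (x : 'rV[R]_n) : 'M[R]_n :=
  (1 / phi x ^+ 2) *: euclidean R n.

(* christoffel G m i j is the symbol Gamma^m_{ij} of the metric G. *)
Definition christoffel (R : realType) (n : nat) (G : 'rV[R]_n -> 'M[R]_n)
    (m i j : 'I_n) (x : 'rV[R]_n) : R :=
  2^-1 * \sum_(l < n) invmx (G x) m l *
    (partial i (fun y => G y j l) x + partial j (fun y => G y i l) x
     - partial l (fun y => G y i j) x).

(* The m-th component of Rm(e_a, e_b) e_d, where
   Rm(X, Y) Z = D_X D_Y Z - D_Y D_X Z - D_[X, Y] Z. *)
Definition curvature_endo (R : realType) (n : nat) (G : 'rV[R]_n -> 'M[R]_n)
    (x : 'rV[R]_n) (a b d m : 'I_n) : R :=
  partial a (christoffel G m b d) x - partial b (christoffel G m a d) x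
  + \sum_(p < n) (christoffel G m a p x * christoffel G p b d x
                  - christoffel G m b p x * christoffel G p a d x).

(* The (0,4)-tensor (X, Y, Z, W) |-> G(Rm(X, Y) W, Z): with this order of the
   arguments constant sectional curvature c means c/2 times the
   Kulkarni-Nomizu square of G. *)
Definition riemann (R : realType) (n : nat) (G : 'rV[R]_n -> 'M[R]_n)
    (x : 'rV[R]_n) : tensor4 R n :=
  fun a b c d => \sum_(m < n) G x c m * curvature_endo G x a b d m.

Definition conformal_solution (R : realType) (n : nat)
    (Rt : 'rV[R]_n -> tensor4 R n) (phi : 'rV[R]_n -> R) : Prop :=
  [/\ smooth phi,
      (forall x, 0 < phi x) &
      (forall x a b c d, riemann (conformal phi) x a b c d = Rt x a b c d)].

(* prim selects one antiderivative of every continuous function; it gives a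
   meaning to the indefinite integral sign. *)
Definition antiderivative_choice (R : realType)
    (prim : (R -> R) -> R -> R) : Prop :=
  forall h : R -> R, continuous h ->
    forall t : R, is_derive t 1 (prim h) (h t).

Definition fratio (R : realType) (f fk : R -> R) (t : R) : R :=
  derive1 f t / (3 * f t + fk t).

Definition ode_system (R : realType) (prim : (R -> R) -> R -> R)
    (f fk : R -> R) (C : R) : Prop :=
  let w := fratio f fk in
  let v := fun t => expR (- 2 * prim w t) in
  forall t : R,
    1 / 2 * w t ^+ 2 - derive1 w t = C ^+ 2 * fk t * v t /\
    - (w t ^+ 2) = 2 * C ^+ 2 * f t * v t.

(* Main.v *)
Require Import Defs.
From HB Require Import structures.
From mathcomp Require Import all_boot all_order all_algebra.
From mathcomp Require Import boolp classical_sets functions reals.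
From mathcomp Require Import topology normedtype sequences derive realfun exp.
From mathcomp Require Import ring lra.

Import Order.TTheory GRing.Theory Num.Theory.
Import numFieldNormedType.Exports.

Local Open Scope ring_scope.
Local Open Scope classical_set_scope.

(** For the conformally flat metric [phi^-2 g] the curvature tensor is
    [phi^-2 (A (.) g)], where the Schouten tensor [A] is
    [Hess phi / phi - |grad phi|^2 / (2 phi^2) g] and [(.)] is the
    Kulkarni-Nomizu product.  As [n >= 3], the product with [g] is injective, so
    the problem is the system [A = phi^2 T], that is [phi_ij = 0] for [i <> j]
    and [phi phi_ii - |grad phi|^2 / 2 = phi^4 f_i].  Since [3 f_k + f_j <> 0],
    its integrability conditions force [phi_j = 0] for [j <> k], so [phi] is a
    function of [x_k] alone.  What remains is a pair of ordinary differential
    equations, whose compatibility reads [phi' (3 f + f_k) = - phi f'] and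
    determines [phi] up to a constant, which the system itself fixes because
    [3 f + f_k <> 0]. *)

Set Implicit Arguments.
Unset Strict Implicit.
Unset Printing Implicit Defensive.

Lemma is_derive_derive1 (R : realType) (f : R -> R) (t : R) :
  derivable f t 1 -> is_derive t 1 f (derive1 f t).
Proof. by rewrite derive1E => /derivableP. Qed.

Lemma derive1_fun_eq (R : realType) (f g : R -> R) :
  (forall t : R, is_derive t 1 f (g t)) -> derive1 f = g.
Proof. by move=> df; apply/funext => t; rewrite derive1E; case: (df t). Qed.

Section DirectionalDerivatives.
Context {R : realType} {V : normedModType R}.
Implicit Types (F : V -> R) (x u v : V).

Lemma is_derive_inv F x v (a : R) : F x != 0 -> is_derive x v F a ->
  is_derive x v (fun y => (F y)^-1) (- F x ^- 2 *: a).
Proof.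
move=> F_neq0 [dF <-].
by apply: DeriveDef; [exact: derivableV|exact: deriveV].
Qed.

Lemma is_derive_line F x v (s a : R) :
  is_derive (x + s *: v) v F a -> is_derive s 1 (fun t : R => F (x + t *: v)) a.
Proof.
case=> dF <-; have quotientE : (fun h : R => h^-1 *:
      (((fun t : R => F (x + t *: v)) \o shift s) (h *: 1) - F (x + s *: v)))
    = (fun h : R => h^-1 *:
      ((F \o shift (x + s *: v)) (h *: v) - F (x + s *: v))).
  by apply/funext => h /=; rewrite [h *: 1]mulr1 scalerDl addrCA.
by apply: DeriveDef; rewrite /derivable /derive quotientE.
Qed.

Lemma is_derive0P F v :
  (forall x, is_derive x v F 0) <-> (forall x (s : R), F (x + s *: v) = F x).
Proof.
split=> [dF x s|F_inv x].
  have := @is_derive_0_is_cst R (fun t => F (x + t *: v)) s 0.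
  by rewrite scale0r addr0; apply=> t; exact: is_derive_line.
have quotient0 : (fun h : R => h^-1 *: ((F \o shift x) (h *: v) - F x))
    = (fun=> 0).
  by apply/funext => h /=; rewrite (addrC (h *: v)) F_inv subrr scaler0.
by apply: DeriveDef; rewrite /derivable /derive quotient0;
  [exact: is_cvg_cst|exact: lim_cst].
Qed.

Lemma is_derive0_derive F u v :
  (forall x, is_derive x v F 0) -> forall x, is_derive x v ('D_u F) 0.
Proof.
move=> /is_derive0P F_inv; apply/is_derive0P => x s; rewrite /derive.
rewrite [X in _ = lim (X @ _)](_ : _ = fun h : R => h^-1 *:
  ((F \o shift (x + s *: v)) (h *: u) - F (x + s *: v))) //.
by apply/funext => h /=; rewrite addrA !F_inv.
Qed.

End DirectionalDerivatives.

Section PartialDerivatives.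
Context {R : realType} {n : nat}.
Implicit Types (F : 'rV[R]_n -> R) (x v : 'rV[R]_n) (i j k : 'I_n).

Lemma Ck_is_derive r F i x :
  Ck r.+1 F -> is_derive x (delta_mx 0 i) F (partial i F x).
Proof. by case=> _ /(_ i)[dF _]; exact: derivableP. Qed.

Lemma Ck_partial r F i : Ck r.+1 F -> Ck r (partial i F).
Proof. by case=> _ /(_ i) []. Qed.

Lemma smooth_partial F i : smooth F -> smooth (partial i F).
Proof. by move=> sF r; exact: Ck_partial (sF r.+1). Qed.

Lemma is_derive_coord (h : R -> R) k x v : derivable h (x 0 k) 1 ->
  is_derive x v (fun y => h (y 0 k)) (v 0 k * derive1 h (x 0 k)).
Proof.
move=> dh; pose coord (y : 'rV[R]_n) := y 0 k.
have diff_coord : differentiable coord x by exact: differentiable_coord.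
have diff_h : differentiable h (coord x) by exact/derivable1_diffP.
apply: DeriveDef; first exact/diff_derivable/(differentiable_comp diff_coord).
rewrite (deriveE _ (differentiable_comp diff_coord diff_h)) diff_comp //=.
rewrite diff1E // -deriveE //; congr (_ * _).
have := derive_mx (@derivable_id R _ x v).
by rewrite derive_id => /matrixP/(_ 0 k); rewrite mxE.
Qed.

Lemma partial_coord (h : R -> R) k i : (forall t, derivable h t 1) ->
  partial i (fun x => h (x 0 k)) = fun x => (i == k)%:R * derive1 h (x 0 k).
Proof.
move=> dh; apply/funext => x.
have dhx := is_derive_coord (delta_mx 0 i) (dh (x 0 k)).
by rewrite /partial derive_val mxE eqxx eq_sym.
Qed.

Lemma derive0_eq_coord k F :
  (forall j, j != k -> forall x, is_derive x (delta_mx 0 j) F 0) ->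
  forall x, F x = F (x 0 k *: delta_mx 0 k).
Proof.
move=> dF x.
have F_inv (r : seq 'I_n) y :
    F (y + \sum_(j <- r | j != k) x 0 j *: delta_mx 0 j) = F y.
  elim/big_rec: _ => [|j z jk IH]; first by rewrite addr0.
  by rewrite addrCA addrC ((is_derive0P _ _).1 (dF j jk)).
by rewrite {1}[x]row_sum_delta (bigD1 k) //= F_inv.
Qed.

Lemma smooth1_line F k x :
  smooth F -> smooth1 (fun t => F (x + t *: delta_mx 0 k)).
Proof.
have is_derive_restriction G (s : R) : smooth G ->
    is_derive s 1 (fun t => G (x + t *: delta_mx 0 k))
      (partial k G (x + s *: delta_mx 0 k)).
  by move=> sG; apply: is_derive_line; exact: Ck_is_derive (sG 1%N).
move=> sF r; elim: r F sF => [|r IH] F sF t.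
  by case: (is_derive_restriction F t sF).
rewrite derive1Sn (derive1_fun_eq (fun s => is_derive_restriction F s sF)).
exact/IH/smooth_partial.
Qed.

End PartialDerivatives.

Arguments Ck_is_derive {R n r F} i x.

Section SmoothFunctions.
Context {R : realType}.
Implicit Types (f g h : R -> R) (m : nat) (t : R).

Fixpoint derivable_upto m f : Prop :=
  if m is m'.+1 then
    (forall t, derivable f t 1) /\ derivable_upto m' (derive1 f)
  else True.

Lemma smooth1P f : smooth1 f <-> forall m, derivable_upto m f.
Proof.
split=> [sf m|df r].
  elim: m f sf => [//|m IH] f sf; split; first exact: (sf 0%N).
  by apply: IH => r t; rewrite -derive1Sn; exact: sf.
elim: r f df => [|r IH] f df t; first exact: (df 1%N).1.
by rewrite derive1Sn; apply: IH => m; exact: (df m.+1).2.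
Qed.

Lemma derivable_uptoW m f : derivable_upto m.+1 f -> derivable_upto m f.
Proof. by elim: m f => [//|m IH] f [df /IH]. Qed.

Lemma derivable_uptoS m f g : (forall t, is_derive t 1 f (g t)) ->
  derivable_upto m g -> derivable_upto m.+1 f.
Proof.
move=> df dg; split=> [t|]; first by case: (df t).
by rewrite (derive1_fun_eq df).
Qed.

Lemma derivable_upto_cst m (c : R) : derivable_upto m (cst c).
Proof.
elim: m c => [//|m IH] c.
by apply: derivable_uptoS (IH 0) => t; exact: is_derive_cst.
Qed.

Lemma derivable_uptoD m f g :
  derivable_upto m f -> derivable_upto m g -> derivable_upto m (f + g).
Proof.
elim: m f g => [//|m IH] f g [df df'] [dg dg'].
apply: derivable_uptoS (IH _ _ df' dg') => t.
by apply: is_deriveD; exact: is_derive_derive1.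
Qed.

Lemma derivable_uptoM m f g :
  derivable_upto m f -> derivable_upto m g -> derivable_upto m (f * g).
Proof.
elim: m f g => [//|m IH] f g df dg.
have dfg' := IH _ _ (derivable_uptoW df) dg.2.
have df'g := IH _ _ (derivable_uptoW dg) df.2.
apply: derivable_uptoS (derivable_uptoD dfg' df'g) => t.
by apply: is_deriveM; apply: is_derive_derive1; [exact: df.1|exact: dg.1].
Qed.

Lemma derivable_uptoV m f : (forall t, f t != 0) ->
  derivable_upto m f -> derivable_upto m (fun t => (f t)^-1).
Proof.
move=> f_neq0; elim: m => [//|m IH] df.
have dV := IH (derivable_uptoW df).
apply: derivable_uptoS (derivable_uptoM (derivable_uptoM
  (derivable_upto_cst m (-1)) (derivable_uptoM dV dV)) df.2) => t.
apply: is_derive_eq (is_deriveV (f_neq0 t) (is_derive_derive1 (df.1 t))) _.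
by rewrite expr2 invfM -[X in X *: _]mulN1r.
Qed.

Lemma smooth1_derive1 f : smooth1 f -> smooth1 (derive1 f).
Proof. by move=> sf r t; rewrite -derive1Sn; exact: sf. Qed.

Lemma smooth1_derivable f : smooth1 f -> forall t, derivable f t 1.
Proof. by move/(_ 0%N). Qed.

Lemma smooth1_continuous f : smooth1 f -> continuous f.
Proof.
move=> sf t; apply: differentiable_continuous; apply/derivable1_diffP.
exact: smooth1_derivable.
Qed.

Lemma smooth1_cst (c : R) : smooth1 (cst c).
Proof. by apply/smooth1P => m; exact: derivable_upto_cst. Qed.

Lemma smooth1D f g : smooth1 f -> smooth1 g -> smooth1 (f + g).
Proof.
move=> /smooth1P sf /smooth1P sg; apply/smooth1P => m.
exact: derivable_uptoD.
Qed.

Lemma smooth1M f g : smooth1 f -> smooth1 g -> smooth1 (f * g).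
Proof.
move=> /smooth1P sf /smooth1P sg; apply/smooth1P => m.
exact: derivable_uptoM.
Qed.

Lemma smooth1V f : (forall t, f t != 0) ->
  smooth1 f -> smooth1 (fun t => (f t)^-1).
Proof.
by move=> f_neq0 /smooth1P sf; apply/smooth1P => m; exact: derivable_uptoV.
Qed.

Lemma smooth1_linear_ode h g : smooth1 g ->
  (forall t, is_derive t 1 h (g t * h t)) -> smooth1 h.
Proof.
move=> /smooth1P sg dh; apply/smooth1P; elim=> [//|m IH].
exact: derivable_uptoS dh (derivable_uptoM (sg m) IH).
Qed.

Lemma smooth1_fratio f g : smooth1 f -> smooth1 g ->
  (forall t, 3 * f t + g t != 0) -> smooth1 (fratio f g).
Proof.
move=> sf sg denom_neq0; apply: smooth1M; first exact: smooth1_derive1.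
have smooth_denom : smooth1 (cst 3 * f + g).
  exact: smooth1D (smooth1M (@smooth1_cst 3) sf) sg.
exact: smooth1V denom_neq0 smooth_denom.
Qed.

Lemma smooth_coord n (k : 'I_n) h :
  smooth1 h -> smooth (fun x : 'rV[R]_n => h (x 0 k)).
Proof.
move=> sh r; have continuous_coord g : smooth1 g ->
    continuous (fun x : 'rV[R]_n => g (x 0 k)).
  move=> sg x; apply: (@continuous_comp _ _ _ (fun y : 'rV[R]_n => y 0 k) g).
    exact: coord_continuous.
  exact: smooth1_continuous.
elim: r h sh => [|r IH] h sh; first by split=> //; exact: continuous_coord.
have dh := smooth1_derivable sh.
split=> [|i]; first exact: continuous_coord.
split=> [x|].
  by case: (is_derive_coord (delta_mx 0 i) (dh (x 0 k))).
rewrite partial_coord //.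
exact: IH _ (smooth1M (@smooth1_cst _) (smooth1_derive1 sh)).
Qed.

End SmoothFunctions.

Lemma exists_third_index n (a b : 'I_n) : (3 <= n)%N ->
  exists2 c : 'I_n, c != a & c != b.
Proof.
move=> n3; have : (0 < #|[predC pred2 a b]|)%N.
  rewrite -(ltn_add2l #|pred2 a b|) cardC card_ord addn0 card2.
  by apply: leq_trans n3; case: (a != b).
by case/card_gt0P => c; rewrite !inE negb_or => /andP[]; exists c.
Qed.

Lemma kulkarni_nomizuZl (R : realType) n (s : R) (A B : 'M[R]_n) a b c e :
  kulkarni_nomizu (s *: A) B a b c e = s * kulkarni_nomizu A B a b c e.
Proof. by rewrite /kulkarni_nomizu !mxE; ring. Qed.

Lemma kulkarni_nomizu_euclidean_inj (R : realType) n (A B : 'M[R]_n) :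
  (3 <= n)%N ->
  (forall a b c e, c != e ->
    kulkarni_nomizu A (euclidean R n) a b c e =
    kulkarni_nomizu B (euclidean R n) a b c e) ->
  A = B.
Proof.
move=> n3 AB; have diag_sum i j : i != j -> A i i + A j j = B i i + B j j.
  move=> ij; have := AB i j i j ij; rewrite /kulkarni_nomizu !mxE !eqxx.
  by rewrite (eq_sym j) (negbTE ij) !mulr1 !mulr0 !subr0.
apply/matrixP => i j; have [<-|ij] := eqVneq i j.
  have [l li _] := exists_third_index i i n3.
  have [m mi ml] := exists_third_index i l n3.
  by move: (diag_sum _ _ li) (diag_sum _ _ mi) (diag_sum _ _ ml); lra.
have [l li lj] := exists_third_index i j n3.
have := AB i l j l; rewrite eq_sym lj => /(_ isT).
rewrite /kulkarni_nomizu !mxE !eqxx (negbTE ij) (negbTE lj) (eq_sym i l).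
by rewrite (negbTE li) !mulr1 !mulr0 !subr0 !addr0.
Qed.

Lemma sum_kronecker (R : pzSemiRingType) n (m : 'I_n) (F : 'I_n -> R) :
  \sum_l (m == l)%:R * F l = F m.
Proof.
rewrite (bigD1 m) //= eqxx mul1r big1 ?addr0 // => l /negbTE lm.
by rewrite eq_sym lm mul0r.
Qed.

(* The Christoffel symbols of exp(-2 w) g, for g Euclidean and u the
   differential of w. *)
Definition conformal_symbol (R : pzRingType) n (u : 'I_n -> R)
    (m i j : 'I_n) : R :=
  (i == j)%:R * u m - (j == m)%:R * u i - (i == m)%:R * u j.

Lemma sum_conformal_symbolM (R : comPzRingType) n (u : 'I_n -> R)
    (m a b e : 'I_n) :
  \sum_p conformal_symbol u m a p * conformal_symbol u p b e =
  (e == m)%:R * u a * u b + (b == m)%:R * u a * u e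
  - (a == e)%:R * u m * u b - (a == b)%:R * u m * u e
  + (a == m)%:R * (2 * u b * u e - (b == e)%:R * \sum_p u p ^+ 2).
Proof.
transitivity (\sum_p (
    (a == p)%:R * (u m * conformal_symbol u p b e)
  - (m == p)%:R * (u a * conformal_symbol u p b e)
  - (a == m)%:R * ((b == e)%:R * u p ^+ 2 - (e == p)%:R * (u p * u b)
      - (b == p)%:R * (u p * u e)))).
  by apply: eq_bigr => p _; rewrite /conformal_symbol (eq_sym p m); ring.
rewrite !sumrB -!mulr_sumr !sumrB -!mulr_sumr !sum_kronecker.
by rewrite /conformal_symbol (eq_sym e a) (eq_sym b a); ring.
Qed.

Section ConformalCurvature.
Context {R : realType} {n : nat}.
Implicit Types (phi : 'rV[R]_n -> R) (x : 'rV[R]_n) (a b c e i j m : 'I_n).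

Definition hessian phi x : 'M[R]_n :=
  \matrix_(i, j) partial i (partial j phi) x.

Definition grad_sqnorm phi x : R := \sum_i partial i phi x ^+ 2.

(* The Schouten tensor of the metric phi^-2 g, for g Euclidean. *)
Definition conformal_schouten phi x : 'M[R]_n :=
  (phi x)^-1 *: hessian phi x - (grad_sqnorm phi x / (2 * phi x ^+ 2))%:M.

Definition dlog phi i x : R := partial i phi x / phi x.

Variable phi : 'rV[R]_n -> R.
Hypothesis phi_C2 : Ck 2 phi.
Hypothesis phi_neq0 : forall x, phi x != 0.

Lemma partial_conformal i j l x :
  partial i (fun y => conformal phi y j l) x =
  (j == l)%:R * (- 2 * partial i phi x / phi x ^+ 3).
Proof.
have dphi := Ck_is_derive i x phi_C2.
have -> : (fun y => conformal phi y j l) =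
    (j == l)%:R \*: (fun y => ((phi ^+ 2) y)^-1).
  by apply/funext => y; rewrite !mxE mul1r mulrC.
have phi2_neq0 : (phi ^+ 2) x != 0 by rewrite exprfctE expf_neq0.
have dV := is_derive_inv phi2_neq0 (is_deriveX 2 dphi).
by rewrite [LHS]/partial derive_val /GRing.scale /= exprfctE; field.
Qed.

Lemma invmx_conformal x m l :
  invmx (conformal phi x) m l = (m == l)%:R * phi x ^+ 2.
Proof.
rewrite /conformal /euclidean scalemx1 invmx_scalar !mxE mul1r invrK.
by rewrite mulr_natl.
Qed.

Lemma christoffel_conformal m i j x :
  christoffel (conformal phi) m i j x = conformal_symbol (dlog phi ^~ x) m i j.
Proof.
rewrite /christoffel.
under eq_bigr => l _ do rewrite invmx_conformal -mulrA !partial_conformal.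
rewrite sum_kronecker /conformal_symbol /dlog.
(* field compares atoms up to conversion and would unfold the derivatives. *)
move: (partial i phi x) (partial j phi x) (partial m phi x) => di dj dm.
by field.
Qed.

Lemma is_derive_dlog i j x :
  is_derive x (delta_mx 0 i) (dlog phi j)
    (hessian phi x i j / phi x - dlog phi i x * dlog phi j x).
Proof.
have dphi := Ck_is_derive i x phi_C2.
have ddphi := Ck_is_derive i x (Ck_partial j phi_C2).
apply: is_derive_eq (is_deriveM ddphi (is_derive_inv (phi_neq0 x) dphi)) _.
rewrite /dlog mxE /GRing.scale /=.
move: (partial i phi x) (partial j phi x) (partial i _ x) => di dj dij.
by field.
Qed.

Lemma partial_christoffel_conformal a m i j x :
  partial a (christoffel (conformal phi) m i j) x =
  conformal_symbol (fun p => hessian phi x a p / phi x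
    - dlog phi a x * dlog phi p x) m i j.
Proof.
have ddlog p := is_derive_dlog a p x.
have -> : christoffel (conformal phi) m i j = (i == j)%:R \*: dlog phi m
    - (j == m)%:R \*: dlog phi i - (i == m)%:R \*: dlog phi j.
  by apply/funext => y; exact: christoffel_conformal.
by rewrite [LHS]/partial derive_val.
Qed.

(* The antisymmetric part of the Hessian vanishes by Clairaut's theorem.
   Keeping it makes that theorem unnecessary: it only affects the components
   with e = c, which kulkarni_nomizu_euclidean_inj does not use. *)
Lemma riemann_conformal x a b c e :
  riemann (conformal phi) x a b c e =
  phi x ^- 2 *
  (kulkarni_nomizu (conformal_schouten phi x) (euclidean R n) a b c e
    - (e == c)%:R * (hessian phi x a b - hessian phi x b a) / phi x).
Proof.
have phi_neq0x := phi_neq0 x.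
have sum_dlog2 : \sum_p dlog phi p x ^+ 2 = grad_sqnorm phi x / phi x ^+ 2.
  by rewrite mulr_suml; apply: eq_bigr => p _; rewrite expr_div_n.
rewrite /riemann.
under eq_bigr => m _ do rewrite !mxE mul1r mulr_natr -mulr_natl -mulrA.
rewrite sum_kronecker /curvature_endo !partial_christoffel_conformal.
under eq_bigr => p _ do rewrite !christoffel_conformal.
rewrite sumrB !sum_conformal_symbolM sum_dlog2 /conformal_symbol.
rewrite /kulkarni_nomizu /conformal_schouten.
move: (dlog phi ^~ x) (hessian phi x) (grad_sqnorm phi x) => u H S.
by rewrite !mxE (eq_sym b a); field.
Qed.

Lemma riemann_conformalP x (A : 'M[R]_n) : (3 <= n)%N -> A^T = A ->
  (forall a b c e, riemann (conformal phi) x a b c e =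
     kulkarni_nomizu A (euclidean R n) a b c e) <->
  conformal_schouten phi x = phi x ^+ 2 *: A.
Proof.
move=> n3 A_sym; have phi2_neq0 : phi x ^+ 2 != 0 by rewrite expf_neq0.
split=> [riemannE|schoutenE a b c e].
  apply: kulkarni_nomizu_euclidean_inj => // a b c e ce.
  rewrite kulkarni_nomizuZl -riemannE riemann_conformal (eq_sym e) (negbTE ce).
  by rewrite !mul0r subr0 mulVKf.
have hessian_sym i j : hessian phi x i j = hessian phi x j i.
  have -> : hessian phi x = phi x *: (phi x ^+ 2 *: A
      + (grad_sqnorm phi x / (2 * phi x ^+ 2))%:M).
    by rewrite -schoutenE subrK scalerA divff // scale1r.
  by rewrite -[in LHS]A_sym !mxE (eq_sym i).
rewrite riemann_conformal hessian_sym subrr mulr0 mul0r subr0 schoutenE.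
by rewrite kulkarni_nomizuZl mulKf.
Qed.

End ConformalCurvature.

Section DiagonalSchouten.
Context {R : realType} {n : nat}.
Implicit Types (phi : 'rV[R]_n -> R) (x : 'rV[R]_n) (i j k : 'I_n).

Lemma conformal_schouten_diagP phi x (d : 'rV[R]_n) : phi x != 0 ->
  conformal_schouten phi x = phi x ^+ 2 *: diag_mx d <->
  (forall i j, i != j -> hessian phi x i j = 0) /\
  (forall i, phi x * hessian phi x i i - grad_sqnorm phi x / 2
     = phi x ^+ 4 * d 0 i).
Proof.
move=> phi_neq0; rewrite /conformal_schouten.
move: (hessian phi x) (grad_sqnorm phi x) => H S.
split=> [schoutenE|[H_offdiag H_diag]].
  split=> [i j /negbTE ij|i].
    move/matrixP/(_ i j): schoutenE; rewrite !mxE ij !mulr0n subr0 mulr0.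
    by move/eqP; rewrite mulf_eq0 invr_eq0 (negbTE phi_neq0) => /eqP.
  move/matrixP/(_ i i): schoutenE; rewrite !mxE eqxx !mulr1n => diag_eq.
  transitivity (phi x ^+ 2 * (phi x ^+ 2 * d 0 i)); last by ring.
  by rewrite -diag_eq; field.
apply/matrixP => i j; rewrite !mxE; have [<-|/H_offdiag ->] := eqVneq i j.
  apply: (mulfI (expf_neq0 2 phi_neq0)); rewrite !mulr1n.
  transitivity (phi x * H i i - S / 2); first by field.
  by rewrite H_diag; ring.
by rewrite !mulr0n !mulr0 subr0.
Qed.

Lemma is_derive_grad_sqnorm phi j x : Ck 2 phi ->
  is_derive x (delta_mx 0 j) (grad_sqnorm phi)
    (2 * \sum_p partial p phi x * hessian phi x j p).
Proof.
move=> phi_C2.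
have -> : grad_sqnorm phi = \sum_p (partial p phi) ^+ 2.
  by apply/funext => y; rewrite fct_sumE.
have ddphi p : is_derive x (delta_mx 0 j) (partial p phi) (hessian phi x j p).
  by rewrite mxE; exact: Ck_is_derive (Ck_partial p phi_C2).
apply: is_derive_eq; rewrite mulr_sumr; apply: eq_bigr => p _.
by rewrite /GRing.scale /= mulrA.
Qed.

Lemma is_derive_schouten_diag phi j k x : Ck 2 phi -> j != k ->
  (forall y p, p != j -> hessian phi y j p = 0) ->
  is_derive x (delta_mx 0 j)
    (fun y => phi y * hessian phi y k k - grad_sqnorm phi y / 2)
    (partial j phi x * (hessian phi x k k - hessian phi x j j)).
Proof.
move=> phi_C2 jk H_offdiag.
have -> : (fun y => phi y * hessian phi y k k - grad_sqnorm phi y / 2)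
    = phi * partial k (partial k phi) - 2^-1 \*: grad_sqnorm phi.
  by apply/funext => y; rewrite !fctE mxE; congr (_ - _); exact: mulrC.
have dphi := Ck_is_derive j x phi_C2.
have dgrad := is_derive_grad_sqnorm j x phi_C2.
have dHkk : is_derive x (delta_mx 0 j) (partial k (partial k phi)) 0.
  apply: is_derive0_derive => y; rewrite -(H_offdiag y k) 1?eq_sym // mxE.
  exact: Ck_is_derive (Ck_partial k phi_C2).
apply: is_derive_eq; rewrite (bigD1 j) //= big1; last first.
  by move=> p pj; rewrite H_offdiag ?mulr0.
rewrite [hessian _ _ k k]mxE /GRing.scale /=.
move: (partial j phi x) (partial k _ x) (hessian phi x j j) => pj Hkk Hjj.
by field.
Qed.

(* Differentiating the k-th diagonal equation along e_j and eliminating the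
   second derivatives leaves (3 d_k + d_j) d_j phi = 0. *)
Lemma partial_eq0_of_schouten phi (d : 'I_n -> 'rV[R]_n -> R) j k :
  Ck 2 phi -> (forall x, phi x != 0) -> j != k ->
  (forall x, conformal_schouten phi x = phi x ^+ 2 *: diag_mx (\row_i d i x)) ->
  (forall x, is_derive x (delta_mx 0 j) (d k) 0) ->
  forall x, 3 * d k x + d j x != 0 -> partial j phi x = 0.
Proof.
move=> phi_C2 phi_neq0 jk schoutenE dk x d_neq0.
have H_offdiag y p : p != j -> hessian phi y j p = 0.
  have /(conformal_schouten_diagP _ (phi_neq0 y))[H0 _] := schoutenE y.
  by rewrite eq_sym; exact: H0.
have diag_eq i : (fun y => phi y * hessian phi y i i - grad_sqnorm phi y / 2)
    = phi ^+ 4 * d i.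
  apply/funext => y.
  have /(conformal_schouten_diagP _ (phi_neq0 y))[_ ->] := schoutenE y.
  by rewrite mxE.
have hessian_diff : phi x * (hessian phi x k k - hessian phi x j j)
    = phi x ^+ 4 * (d k x - d j x).
  have := congr1 (@^~ x) (diag_eq k); have := congr1 (@^~ x) (diag_eq j).
  by rewrite !fctE /=; lra.
have dphi := Ck_is_derive j x phi_C2.
have := is_derive_schouten_diag x phi_C2 jk H_offdiag; rewrite diag_eq.
case=> _; rewrite derive_val /GRing.scale /= mulr0 add0r => d_diag_eq.
apply: (mulIf d_neq0); apply: (mulIf (expf_neq0 4 (phi_neq0 x))).
move: d_diag_eq hessian_diff; move: (partial j phi x) (hessian phi x k k)
  (hessian phi x j j) => pj Hkk Hjj d_diag_eq hessian_diff.
transitivity (phi x * (d k x * (4 * phi x ^+ 3 * pj))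
  - pj * (phi x ^+ 4 * (d k x - d j x))); first by ring.
by rewrite d_diag_eq -hessian_diff; ring.
Qed.

Lemma grad_sqnorm_coord (h : R -> R) k x : (forall t, derivable h t 1) ->
  grad_sqnorm (fun y : 'rV[R]_n => h (y 0 k)) x = derive1 h (x 0 k) ^+ 2.
Proof.
move=> dh; rewrite /grad_sqnorm (bigD1 k) //= partial_coord // eqxx mul1r.
rewrite big1 ?addr0 // => i /negbTE ik.
by rewrite partial_coord // ik mul0r expr0n.
Qed.

Lemma hessian_coord (h : R -> R) k x i j :
  (forall t, derivable h t 1) -> (forall t, derivable (derive1 h) t 1) ->
  hessian (fun y : 'rV[R]_n => h (y 0 k)) x i j =
  (i == k)%:R * (j == k)%:R * derive1 (derive1 h) (x 0 k).
Proof.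
move=> dh ddh; rewrite mxE partial_coord //.
rewrite (partial_coord (h := (j == k)%:R \*: derive1 h)) => [|t].
  by rewrite derive1E deriveZ // -derive1E mulrA.
exact: derivableZ.
Qed.

Definition conformal_ode (fk f h : R -> R) : Prop := forall t,
  h t * derive1 (derive1 h) t - derive1 h t ^+ 2 / 2 = h t ^+ 4 * fk t /\
  - (derive1 h t ^+ 2 / 2) = h t ^+ 4 * f t.

Lemma conformal_schouten_coordP (h : R -> R) (d : 'I_n -> R -> R) k :
  (3 <= n)%N -> (forall t, derivable h t 1) ->
  (forall t, derivable (derive1 h) t 1) -> (forall t, h t != 0) ->
  (forall x, conformal_schouten (fun y => h (y 0 k)) x =
     h (x 0 k) ^+ 2 *: diag_mx (\row_i d i (x 0 k))) <->
  (forall i, i != k -> conformal_ode (d k) (d i) h).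
Proof.
move=> n3 dh ddh h_neq0.
have schoutenP (x : 'rV[R]_n) := conformal_schouten_diagP
  (phi := fun y => h (y 0 k)) (\row_i d i (x 0 k)) (h_neq0 (x 0 k)).
split=> [schoutenE i ik t|ode x].
  have /schoutenP[_ diag_eq] := schoutenE (t *: delta_mx 0 k).
  move: (diag_eq k) (diag_eq i); rewrite !hessian_coord // grad_sqnorm_coord //.
  by rewrite !mxE !eqxx (negbTE ik) !mulr1 !mul1r !mul0r mulr0 sub0r.
apply/schoutenP; split=> [i j ij|i]; rewrite hessian_coord //.
  have [ik|_] := eqVneq i k; last by rewrite !mul0r.
  by rewrite -ik eq_sym (negbTE ij) mulr0 mul0r.
rewrite grad_sqnorm_coord // mxE; have [->|ik] := eqVneq i k.
  have [j jk _] := exists_third_index k k n3.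
  by rewrite !mul1r; case: (ode j jk (x 0 k)).
by rewrite !mul0r mulr0 sub0r; case: (ode i ik (x 0 k)).
Qed.

End DiagonalSchouten.

Section LinearOde.
Context {R : realType}.
Variables W w : R -> R.
Hypothesis dW : forall t : R, is_derive t 1 W (w t).

Lemma is_derive_expR_primitive (C t : R) :
  is_derive t 1 (fun s => C * expR (- W s)) (- w t * (C * expR (- W t))).
Proof.
have dexp : is_derive t 1 (expR \o - W) (expR (- W t) * - w t).
  exact: is_derive1_comp.
apply: is_derive_eq (is_deriveZ C dexp) _.
by rewrite /GRing.scale /=; ring.
Qed.

Lemma linear_ode_unique (h : R -> R) :
  (forall t : R, is_derive t 1 h (- w t * h t)) ->
  forall t, h t = h 0 * expR (W 0) * expR (- W t).
Proof.
move=> dh t; suff -> : h 0 * expR (W 0) = h t * expR (W t).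
  by rewrite -mulrA -expRD subrr expR0 mulr1.
apply: (is_derive_0_is_cst (f := h * (expR \o W))) => s.
apply: is_derive_eq; rewrite /GRing.scale /=.
by ring.
Qed.

End LinearOde.

Section ConformalOde.
Context {R : realType}.
Implicit Types (f fk h : R -> R) (t : R).

Lemma conformal_ode_derive1 f fk h t :
  conformal_ode fk f h -> derivable f t 1 -> derivable h t 1 ->
  derivable (derive1 h) t 1 -> h t != 0 -> 3 * f t + fk t != 0 ->
  derive1 h t = - fratio f fk t * h t.
Proof.
move=> ode /is_derive_derive1 df /is_derive_derive1 dh /is_derive_derive1 ddh.
move=> h_neq0 f_neq0; have [ode_k ode_f] := ode t.
have ode_f_fun : - (2^-1 \*: derive1 h ^+ 2) = h ^+ 4 * f.
  apply/funext => s; rewrite !fctE -(ode s).2.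
  by congr (- _); exact: mulrC.
have := congr1 (fun F => 'D_1 F t) ode_f_fun; rewrite derive_val derive_val.
rewrite /GRing.scale /= exprfctE => d_ode_f.
have h_ddh : h t * derive1 (derive1 h) t = h t ^+ 4 * (fk t - f t) by lra.
have compatibility :
    derive1 h t * (3 * f t + fk t) = - (derive1 f t * h t).
  apply: (mulfI (expf_neq0 4 h_neq0)).
  transitivity (derive1 h t * (h t * derive1 (derive1 h) t)
    + 4 * h t ^+ 4 * derive1 h t * f t); first by rewrite h_ddh; ring.
  transitivity (h t * (h t ^+ 4 * - derive1 f t)); last by ring.
  by move/(congr1 ( *%R (h t))): d_ode_f; lra.
by apply: (mulIf f_neq0); rewrite compatibility /fratio; field.
Qed.

(* With h' = - w h one has h'' = (w^2 - w') h. *)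
Lemma conformal_ode_linearP (w f fk h : R -> R) :
  (forall t : R, derivable w t 1) -> (forall t, h t != 0) ->
  (forall t : R, is_derive t 1 h (- w t * h t)) ->
  conformal_ode fk f h <->
  (forall t, 1 / 2 * w t ^+ 2 - derive1 w t = h t ^+ 2 * fk t /\
             - (w t ^+ 2) = 2 * h t ^+ 2 * f t).
Proof.
move=> dw h_neq0 dh; have derive1_h := derive1_fun_eq dh.
have derive2_h t : derive1 (derive1 h) t = (w t ^+ 2 - derive1 w t) * h t.
  have dwt := is_derive_derive1 (dw t).
  rewrite derive1_h derive1E; have -> : (fun t => - w t * h t) = - w * h by [].
  by rewrite derive_val opprfctE /GRing.scale /=; ring.
have radial_lhs t : h t * derive1 (derive1 h) t - derive1 h t ^+ 2 / 2
    = h t ^+ 2 * (1 / 2 * w t ^+ 2 - derive1 w t).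
  by rewrite derive2_h derive1_h; field.
have transverse_lhs t :
    - (derive1 h t ^+ 2 / 2) = h t ^+ 2 * (- (w t ^+ 2) / 2).
  by rewrite derive1_h; field.
split=> ode t; move: (ode t); rewrite radial_lhs transverse_lhs => -[].
  move=> ode_k ode_f; have h2_neq0 : h t ^+ 2 != 0 by rewrite expf_neq0.
  split; first by apply: (mulfI h2_neq0); rewrite ode_k; ring.
  apply: (mulfI h2_neq0); transitivity (2 * (h t ^+ 4 * f t)); last by ring.
  by rewrite -ode_f; field.
by move=> -> ->; split; field.
Qed.

Section IndefiniteIntegral.
Variables (prim : (R -> R) -> R -> R) (f fk : R -> R).
Hypothesis primP : antiderivative_choice prim.
Hypothesis sf : smooth1 f.
Hypothesis sfk : smooth1 fk.
Hypothesis f_fk_neq0 : forall t, 3 * f t + fk t != 0.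

Definition conformal_factor (C t : R) : R := C * expR (- prim (fratio f fk) t).

Lemma conformal_factor_gt0 C t : 0 < C -> 0 < conformal_factor C t.
Proof. by move=> C_gt0; rewrite mulr_gt0 ?expR_gt0. Qed.

Lemma is_derive_prim_fratio t :
  is_derive t 1 (prim (fratio f fk)) (fratio f fk t).
Proof. by apply: primP; exact/smooth1_continuous/smooth1_fratio. Qed.

Lemma is_derive_conformal_factor C t :
  is_derive t 1 (conformal_factor C) (- fratio f fk t * conformal_factor C t).
Proof. exact: is_derive_expR_primitive is_derive_prim_fratio C t. Qed.

Lemma smooth1_conformal_factor C : smooth1 (conformal_factor C).
Proof.
apply: (smooth1_linear_ode (g := cst (-1) * fratio f fk)) => [|t].
  by apply: smooth1M; [exact: smooth1_cst|exact: smooth1_fratio].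
by apply: is_derive_eq (is_derive_conformal_factor C t) _; rewrite !fctE mulN1r.
Qed.

Lemma ode_systemP C : 0 < C ->
  ode_system prim f fk C <-> conformal_ode fk f (conformal_factor C).
Proof.
move=> C_gt0.
have factor2E t : conformal_factor C t ^+ 2
    = C ^+ 2 * expR (- 2 * prim (fratio f fk) t).
  by rewrite exprMn -expRM_natl; congr (_ * expR _); ring.
have dw := smooth1_derivable (smooth1_fratio sf sfk f_fk_neq0).
have odeP := conformal_ode_linearP f fk dw
  (fun t => lt0r_neq0 (conformal_factor_gt0 t C_gt0))
  (is_derive_conformal_factor C).
apply: iff_trans (iff_sym odeP); rewrite /ode_system /=.
by split=> sys t; have [-> ->] := sys t; rewrite factor2E; split; ring.
Qed.

Lemma conformal_odeP h : smooth1 h -> (forall t, 0 < h t) ->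
  conformal_ode fk f h <->
  exists C, [/\ 0 < C, ode_system prim f fk C & h = conformal_factor C].
Proof.
move=> sh h_gt0; split=> [ode|[C [C_gt0 /ode_systemP -/(_ C_gt0) ode ->//]]].
have dh t : is_derive t 1 h (- fratio f fk t * h t).
  rewrite -(conformal_ode_derive1 ode _ _ _ (lt0r_neq0 (h_gt0 t))) //.
  - exact/is_derive_derive1/smooth1_derivable.
  - exact: smooth1_derivable.
  - exact: smooth1_derivable.
  - exact/smooth1_derivable/smooth1_derive1.
pose C := h 0 * expR (prim (fratio f fk) 0).
have C_gt0 : 0 < C by rewrite mulr_gt0 ?expR_gt0.
have hE : h = conformal_factor C.
  by apply/funext => t; exact: (linear_ode_unique is_derive_prim_fratio dh).
by exists C; split=> //; apply/ode_systemP => //; rewrite -hE.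
Qed.

Lemma ode_system_unique C D : 0 < C -> 0 < D ->
  ode_system prim f fk C -> ode_system prim f fk D -> C = D.
Proof.
move=> C_gt0 D_gt0 /(_ 0)[C_k C_f] /(_ 0)[D_k D_f].
have v_neq0 : expR (- 2 * prim (fratio f fk) 0) != 0.
  by rewrite gt_eqF ?expR_gt0.
have eq_sqr : C ^+ 2 = D ^+ 2.
  by apply: (mulIf v_neq0); apply: (mulIf (f_fk_neq0 0)); lra.
by apply/eqP; rewrite -(eqrXn2 (n := 2)) ?ltW // eq_sqr.
Qed.

End IndefiniteIntegral.
End ConformalOde.

Section PrescribedCurvature.
Context {R : realType} {n : nat} (k : 'I_n) (fs : 'I_n -> R -> R).
Hypothesis n3 : (3 <= n)%N.
Implicit Types (phi : 'rV[R]_n -> R) (x : 'rV[R]_n) (i j : 'I_n).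

Definition prescribed_curvature x : tensor4 R n :=
  kulkarni_nomizu (diag_mx (\row_i fs i (x 0 k))) (euclidean R n).

Lemma conformal_solution_schoutenP phi :
  conformal_solution prescribed_curvature phi <->
  [/\ smooth phi, forall x, 0 < phi x &
      forall x, conformal_schouten phi x =
        phi x ^+ 2 *: diag_mx (\row_i fs i (x 0 k))].
Proof.
have curvatureP : smooth phi -> (forall x, 0 < phi x) -> forall x,
    (forall a b c e, riemann (conformal phi) x a b c e =
       prescribed_curvature x a b c e) <->
    conformal_schouten phi x = phi x ^+ 2 *: diag_mx (\row_i fs i (x 0 k)).
  move=> sphi phi_gt0 x; apply: riemann_conformalP => //.
  - by move=> y; rewrite gt_eqF.
  - exact: tr_diag_mx.
by split=> -[sphi phi_gt0 curvature_eq]; split=> // x; apply/curvatureP.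
Qed.

Lemma conformal_solution_coordP (h : R -> R) :
  smooth1 h -> (forall t, 0 < h t) ->
  conformal_solution prescribed_curvature (fun x => h (x 0 k)) <->
  (forall i, i != k -> conformal_ode (fs k) (fs i) h).
Proof.
move=> sh h_gt0; have h_neq0 t : h t != 0 by rewrite gt_eqF.
have dh := smooth1_derivable sh.
have ddh := smooth1_derivable (smooth1_derive1 sh).
have schoutenP := conformal_schouten_coordP fs k n3 dh ddh h_neq0.
split=> [/conformal_solution_schoutenP[_ _ /schoutenP]//|/schoutenP schoutenE].
by apply/conformal_solution_schoutenP; split=> //; exact: smooth_coord.
Qed.

Lemma conformal_solution_profile phi : (forall t, derivable (fs k) t 1) ->
  (forall j, j != k -> forall t, 3 * fs k t + fs j t != 0) ->
  conformal_solution prescribed_curvature phi ->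
  exists h, [/\ smooth1 h, forall t, 0 < h t & phi = fun x => h (x 0 k)].
Proof.
move=> dfk fs_neq0 /conformal_solution_schoutenP[sphi phi_gt0 schoutenE].
exists (fun t => phi (t *: delta_mx 0 k)); split=> //.
  have := smooth1_line (k := k) (x := 0) sphi.
  by under eq_fun do rewrite add0r.
apply/funext; apply: derive0_eq_coord => j jk x.
suff <- : partial j phi x = 0 by exact: Ck_is_derive (sphi 1%N).
apply: (partial_eq0_of_schouten (d := fun i y => fs i (y 0 k)) _ _ jk) => //.
- by move=> y; rewrite gt_eqF.
- move=> y; apply: is_derive_eq (is_derive_coord _ (dfk _)) _.
  by rewrite mxE (eq_sym k) (negbTE jk) andbF mul0r.
- exact: fs_neq0.
Qed.

Hypothesis fs_smooth : forall i, smooth1 (fs i).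
Hypothesis fs_neq0 : forall i j, i != j -> forall t, 3 * fs i t + fs j t != 0.
Variable prim : (R -> R) -> R -> R.
Hypothesis primP : antiderivative_choice prim.

Lemma conformal_solutionP phi :
  conformal_solution prescribed_curvature phi <->
  exists f C, [/\ forall i, i != k -> fs i = f, 0 < C,
    ode_system prim f (fs k) C &
    phi = fun x => conformal_factor prim f (fs k) C (x 0 k)].
Proof.
have odeP i h (ik : i != k) := conformal_odeP (h := h) primP (@fs_smooth i)
  (@fs_smooth k) (fs_neq0 ik).
have [i0 i0k _] := exists_third_index k k n3.
split=> [solution|[f [C [fsE C_gt0 sys ->]]]].
- have [||h [sh h_gt0 phiE]] := conformal_solution_profile _ _ solution.
  + exact: smooth1_derivable.
  + by move=> j jk; apply: fs_neq0; rewrite eq_sym.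
  move: solution; rewrite phiE => /conformal_solution_coordP -/(_ sh h_gt0) ode.
  have fsE i : i != k -> fs i = fs i0.
    move=> ik; apply/funext => t.
    apply: (mulfI (expf_neq0 4 (lt0r_neq0 (h_gt0 t)))).
    by rewrite -(ode i ik t).2 -(ode i0 i0k t).2.
  have /(odeP _ _ i0k sh h_gt0)[C [C_gt0 sys ->]] := ode i0 i0k.
  by exists (fs i0), C.
- have h_gt0 t := conformal_factor_gt0 prim f (fs k) t C_gt0.
  have sh : smooth1 (conformal_factor prim f (fs k) C).
    rewrite -(fsE i0 i0k).
    exact: (smooth1_conformal_factor primP (@fs_smooth i0) (@fs_smooth k)
      (fs_neq0 i0k)).
  apply/conformal_solution_coordP => // i ik.
  rewrite -(fsE i ik) in sys h_gt0 sh *.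
  by apply/odeP => //; exists C.
Qed.

End PrescribedCurvature.

Theorem theorem3p6 (R : realType) (n : nat) (hn : (3 <= n)%N) (k : 'I_n)
    (fs : 'I_n -> R -> R)
    (fs_smooth : forall i, smooth1 (fs i))
    (fs_neq0 : forall i j : 'I_n, i != j ->
       forall t : R, 3 * fs i t + fs j t != 0)
    (prim : (R -> R) -> R -> R) (primP : antiderivative_choice prim) :
  let T := fun x : 'rV[R]_n => diag_mx (\row_(i < n) fs i (x 0 k)) in
  let Rt := fun x : 'rV[R]_n => kulkarni_nomizu (T x) (euclidean R n) in
  let conditions := fun (f : R -> R) (C : R) =>
    [/\ (forall i : 'I_n, i != k -> fs i = f), 0 < C &
        ode_system prim f (fs k) C] in
  ((exists phi : 'rV[R]_n -> R, conformal_solution Rt phi) <->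
   (exists (f : R -> R) (C : R), conditions f C)) /\
  (forall (f : R -> R) (C : R), conditions f C ->
   forall phi : 'rV[R]_n -> R,
     conformal_solution Rt phi <->
     (forall x, phi x = C * expR (- prim (fratio f (fs k)) (x 0 k)))).
Proof.
move=> T Rt conditions.
have solutionP := conformal_solutionP k hn fs_smooth fs_neq0 primP.
split.
  split=> [[phi /solutionP[f [C [fsE C_gt0 sys _]]]]|[f [C [fsE C_gt0 sys]]]].
    by exists f, C.
  exists (fun x => conformal_factor prim f (fs k) C (x 0 k)).
  by apply/solutionP; exists f, C.
move=> f C [fsE C_gt0 sys] phi; split=> [/solutionP|phiE]; last first.
  by apply/solutionP; exists f, C; split=> //; exact/funext.
move=> [f' [D [fsE' D_gt0 sys' -> x]]].
have [i ik _] := exists_third_index k k hn.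
have f_neq0 t : 3 * f t + fs k t != 0 by rewrite -(fsE i ik); exact: fs_neq0.
rewrite -(fsE' i ik) (fsE i ik) in sys' *.
by rewrite (ode_system_unique f_neq0 C_gt0 D_gt0 sys sys').
Qed.
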